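(* Let $s$, $t$ and $k$ be positive integers with $t\geq s\geq k$. Then \[ TC_{k}(K_{s,t})=\begin{cases} t-k+2, & \text{if } k\leq s\leq 3k-2;\\ s+t-4k+4, & \text{if } s\geq 3k-1. \end{cases} \]
   Context: $K_{s,t}$ is the complete bipartite graph with partite sets of sizes $s$ and $t$. Let $G$ be a graph with minimum degree $\delta(G)\geq k$. A set $S\subseteq V(G)$ is a total $k$-dominating set of $G$ if every vertex $v\in V(G)$ has at least $k$ neighbors in $S$. Two disjoint sets $A,B\subseteq V(G)$ form a total $k$-coalition if neither $A$ nor $B$ is a total $k$-dominating set of $G$ but $A\cup B$ is a total $k$-dominating set of $G$. A total $k$-coalition partition of $G$ is a partition $\Omega$ of $V(G)$ in which every set forms a total $k$-coalition with another set of $\Omega$. The total $k$-coalition number $TC_k(G)$ is the maximum cardinality of a total $k$-coalition partition of $G$. *)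

(* Defs.v *)
From mathcomp Require Import all_boot.

Set Implicit Arguments.
Unset Strict Implicit.
Unset Printing Implicit Defensive.

Record sgraph := SGraph {
  vertex :> finType;
  adj : rel vertex;
  adj_sym : symmetric adj;
  adj_irr : irreflexive adj
}.

Definition neighbors (G : sgraph) (v : G) : {set G} := [set w | adj v w].

Definition total_dominating (k : nat) (G : sgraph) (S : {set G}) : bool :=
  [forall v : G, k <= #|neighbors v :&: S|].

Definition total_coalition (k : nat) (G : sgraph) (A B : {set G}) : bool :=
  [&& [disjoint A & B],
      ~~ total_dominating k A,
      ~~ total_dominating k B
    & total_dominating k (A :|: B)].

Definition total_coalition_partition (k : nat) (G : sgraph)
    (Omega : {set {set G}}) : bool :=
  partition Omega [set: G] &&
  [forall A in Omega,
     [exists B in Omega, (B != A) && total_coalition k A B]].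

(* Only meaningful for graphs of minimum degree at least k. The value is 0
   when G has no total k-coalition partition. *)
Definition total_coalition_number (k : nat) (G : sgraph) : nat :=
  \max_(Omega : {set {set G}} | total_coalition_partition k Omega) #|Omega|.

Definition Kbip_adj (s t : nat) : rel ('I_s + 'I_t)%type :=
  fun u v => match u, v with
             | inl _, inr _ | inr _, inl _ => true
             | _, _ => false
             end.

Lemma Kbip_adj_sym (s t : nat) : symmetric (@Kbip_adj s t).
Proof. by case=> x; case=> y. Qed.

Lemma Kbip_adj_irr (s t : nat) : irreflexive (@Kbip_adj s t).
Proof. by case. Qed.

Definition complete_bipartite (s t : nat) : sgraph :=
  SGraph (@Kbip_adj_sym s t) (@Kbip_adj_irr s t).

(* Main.v *)
(** A vertex set is total k-dominating in K_{s,t} exactly when it has at least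
    k vertices on each side, so a coalition pair has at least 2k vertices. If a
    coalition partition contains two disjoint coalition pairs, those four parts
    cover at least 4k vertices and every other part at least one, whence at most
    s + t - 4k + 4 parts. Otherwise some part A forms a coalition with every other
    part; on a side where A has b < k vertices every other part has at least
    k - b >= 1, which leaves room for at most t - k + 2 parts. Both bounds are
    attained by partitions with one or two large parts and singletons. *)
Require Import Defs.
From mathcomp Require Import all_boot zify.

Set Implicit Arguments.
Unset Strict Implicit.
Unset Printing Implicit Defensive.

(** * Stars and disjoint edges in graphs without isolated vertices *)

(** Take an edge [a b]. If neither end is the centre of a star, there are non-neighbours [d] of [a]
    and [c] of [b]. Two disjoint edges are then found among [a b] and edges at [c] and [d]. *)
Lemma star_or_disjoint_edges (T : finType) (P : {set T}) (e : rel T) :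
    symmetric e -> irreflexive e -> P != set0 ->
    (forall a, a \in P -> exists2 b, b \in P & e a b) ->
  (exists2 a, a \in P & forall b, b \in P -> b != a -> e a b) \/
  (exists a b c d, [/\ uniq [:: a; b; c; d],
     {subset [:: a; b; c; d] <= P}, e a b & e c d]).
Proof.
move=> e_sym e_irr /set0Pn[a Pa] deg; have [b Pb eab] := deg a Pa.
have e_neq x y : e x y -> x != y.
  by move=> exy; apply/eqP=> eq_xy; rewrite eq_xy e_irr in exy.
have disj_edges x y z w : x \in P -> y \in P -> z \in P -> w \in P ->
    uniq [:: x; y; z; w] -> e x y -> e z w ->
  (exists a b c d, [/\ uniq [:: a; b; c; d],
     {subset [:: a; b; c; d] <= P}, e a b & e c d]).
  move=> Px Py Pz Pw uniq_xyzw exy ezw; exists x, y, z, w; split=> // v.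
  by rewrite !inE => /or4P[] /eqP->.
have nonstar x : ~~ [forall y in P, (y != x) ==> e x y] ->
    exists y, [/\ y \in P, y != x & ~~ e x y].
  rewrite negb_forall => /existsP[y]; rewrite !negb_imply => /and3P[Py yx exy].
  by exists y.
have star x : x \in P -> [forall y in P, (y != x) ==> e x y] ->
    exists2 a, a \in P & forall b, b \in P -> b != a -> e a b.
  move=> Px /forall_inP all_x; exists x => // y Py.
  by apply/implyP; apply: all_x.
case: (boolP [forall y in P, (y != a) ==> e a y]) => [|/nonstar].
  by left; exact: (star a).
case=> d [Pd da ead].
case: (boolP [forall y in P, (y != b) ==> e b y]) => [|/nonstar].
  by left; exact: (star b).
case=> c [Pc cb ebc]; right.
have db : d != b by apply: contraNneq ead => ->.
have ca : c != a by apply: contraNneq ebc => ->; rewrite e_sym.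
have [d' Pd' edd'] := deg d Pd; have [c' Pc' ecc'] := deg c Pc.
have ab := e_neq _ _ eab; have dd' := e_neq _ _ edd'; have cc' := e_neq _ _ ecc'.
have d'a : d' != a by apply: contraNneq ead => <-; rewrite e_sym.
have c'b : c' != b by apply: contraNneq ebc => <-; rewrite e_sym.
(* A neighbour of [d] other than [b], or a neighbour of [c] other than [a], gives an edge disjoint
   from [a b]. Otherwise the edges [c a] and [d b] remain, and they are disjoint. *)
have [d'b|d'b] := eqVneq d' b; last first.
  apply: (disj_edges a b d d') => //=; rewrite !inE !negb_or.
  by rewrite ab dd' !(eq_sym a) !(eq_sym b) da d'a db d'b.
have [c'a|c'a] := eqVneq c' a; last first.
  apply: (disj_edges a b c c') => //=; rewrite !inE !negb_or.
  by rewrite ab cc' !(eq_sym a) !(eq_sym b) ca c'a cb c'b.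
subst c' d'.
have cd : c != d by apply: contraNneq ead => <-; rewrite e_sym.
apply: (disj_edges c a d b) => //=; rewrite !inE !negb_or.
by rewrite ca cd cb (eq_sym a d) da ab db.
Qed.

(** * Counting in partitions *)

(** Every part outside [J] is nonempty and so uses at least one element of [D]; the parts in [J] are
    split off one by one. *)
Lemma leq_card_partition (T : finType) (P : {set {set T}}) (D : {set T})
    (J : seq {set T}) :
    partition P D -> uniq J -> {subset J <= P} ->
  #|P| + \sum_(A <- J) #|A| <= #|D| + size J.
Proof.
move=> partP; elim: J P D partP => [|A J IH] P D partP /=.
  rewrite big_nil !addn0 (card_partition partP) -sum1_card => _ _.
  by apply: leq_sum => A PA; rewrite card_gt0 (partition_neq0 partP).
move=> /andP[AJ uniqJ] sJP.
have PA : A \in P by rewrite sJP ?mem_head.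
have := IH _ _ (partitionD1 partP PA) uniqJ.
have sub : {subset J <= P :\ A}.
  move=> B JB; rewrite !inE sJP ?inE ?JB ?orbT // andbT.
  by apply: contraNneq AJ => <-.
move=> /(_ sub); rewrite big_cons (cardsD1 A P) PA.
have := cardsID A D; rewrite (setIidPr (partitionS partP PA)).
move: (\sum_(B <- J) #|B|) #|D| #|A| #|D :\: A| #|P :\ A| => *; lia.
Qed.

Lemma leq_card_partition_star (T : finType) (P : {set {set T}}) (X A : {set T})
    (k : nat) :
    partition P [set: T] -> 1 < #|P| -> A \in P -> #|X :&: A| < k ->
    (forall B, B \in P -> B != A -> k <= #|X :&: A| + #|X :&: B|) ->
  #|P| + k <= #|X| + 2.
Proof.
move=> partP + PA ltAk geP.
have -> : #|X| = \sum_(B in P) #|X :&: B|.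
  have := set_partition_big_cond (op := addn) (K := [in X]) (E := fun=> 1) P partP.
  rewrite (eq_bigl [in X]) => [|x]; last by rewrite inE.
  rewrite sum1_card => ->; apply: eq_bigr => B _.
  by rewrite -sum1_card; apply: eq_bigl => x; rewrite inE andbC.
rewrite (bigD1 A) //=.
have : \sum_(B in P | B != A) (k - #|X :&: A|) <=
       \sum_(B in P | B != A) #|X :&: B|.
  by apply: leq_sum => B /andP[PB BA]; rewrite leq_subLR geP.
rewrite sum_nat_const (cardsD1 A P) PA.
have -> : #|[pred B in P | B != A]| = #|P :\ A|.
  by apply: eq_card => B; rewrite !inE andbC.
set S := \sum_(B in P | _) _; move: #|P :\ A| S => p S le_S p_gt0.
(* With [a = #|X :&: A|], both [p] and [k - a] are at least 1, so
   [p * (k - a) >= p + (k - a) - 1]. *)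
nia.
Qed.

Lemma partition_singletons (T : finType) (D : {set T}) :
  partition [set [set x] | x in D] D.
Proof.
apply/and3P; split.
- by rewrite cover_imset; apply/eqP/setP=> x; apply/bigcupP/idP => [[y Dy /set1P->]|Dx] //;
    exists x; rewrite ?set11.
- apply/trivIsetP=> _ _ /imsetP[x _ ->] /imsetP[y _ ->] xy.
  by rewrite disjoints1 inE; apply: contraNneq xy => ->.
- by apply/imsetP=> -[x _ /esym/eqP]; apply/negP; apply/set0Pn; exists x; rewrite set11.
Qed.

Lemma card_singletons (T : finType) (D : {set T}) :
  #|[set [set x] | x in D]| = #|D|.
Proof. by rewrite card_imset //; exact: set1_inj. Qed.

(** Ensures that adjoining a new part to a partition raises the number of parts by exactly one. *)
Lemma partition_notin (T : finType) (P : {set {set T}}) (A D : {set T}) :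
  partition P D -> A != set0 -> [disjoint A & D] -> A \notin P.
Proof.
move=> partP /set0Pn[x Ax] dAD; apply/negP=> PA.
by have := disjointFr dAD Ax; rewrite (subsetP (partitionS partP PA)).
Qed.

(** * Domination and coalitions through the vertex counts on the two sides *)

Section CompleteBipartite.

Variables (s t k : nat).
Hypotheses (s_gt0 : 0 < s) (t_gt0 : 0 < t) (k_gt0 : 0 < k).

Notation G := (complete_bipartite s t).
Implicit Types (A B : {set G}) (Omega : {set {set G}}).

Definition left_side : {set G} := [set inl i | i : 'I_s].
Definition right_side : {set G} := [set inr j | j : 'I_t].
Definition nleft A := #|left_side :&: A|.
Definition nright A := #|right_side :&: A|.

Lemma in_left_side (v : G) : (v \in left_side) = if v is inl _ then true else false.
Proof.
by case: v => [i|j]; [apply/imsetP; exists i|apply/negP=> /imsetP[]].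
Qed.

Lemma in_right_side (v : G) : (v \in right_side) = if v is inl _ then false else true.
Proof.
by case: v => [i|j]; [apply/negP=> /imsetP[]|apply/imsetP; exists j].
Qed.

Lemma card_left_side : #|left_side| = s.
Proof. by rewrite card_imset ?card_ord //; move=> i j []. Qed.

Lemma card_right_side : #|right_side| = t.
Proof. by rewrite card_imset ?card_ord //; move=> i j []. Qed.

Lemma card_nleft_nright A : #|A| = nleft A + nright A.
Proof.
rewrite -(cardsID left_side A) setIC; congr (_ + _).
by apply: eq_card => v; rewrite !inE in_left_side in_right_side; case: v.
Qed.

Lemma nleft1 (v : G) : nleft [set v] = if v is inl _ then 1 else 0.
Proof.
rewrite /nleft; have := in_left_side v; case: v => v inv.
  by rewrite (setIidPr _) ?sub1set // cards1.
by apply: eq_card0 => w; rewrite !inE; case: eqP => [->|]; rewrite ?inv ?andbF.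
Qed.

Lemma nright1 (v : G) : nright [set v] = if v is inl _ then 0 else 1.
Proof.
by have := card_nleft_nright [set v]; rewrite cards1 nleft1; case: v => v; lia.
Qed.

Lemma total_dominatingE A :
  total_dominating k A = (k <= nleft A) && (k <= nright A).
Proof.
have nbl i : neighbors (inl i : G) = right_side.
  by apply/setP=> v; rewrite inE in_right_side; case: v.
have nbr j : neighbors (inr j : G) = left_side.
  by apply/setP=> v; rewrite inE in_left_side; case: v.
apply/forallP/andP => [domA|[kl kr] [i|j]]; last 2 first.
- by rewrite nbl.
- by rewrite nbr.
(* Each side has a vertex, and its neighborhood is the whole opposite side. *)
have := domA (inl (Ordinal s_gt0)); have := domA (inr (Ordinal t_gt0)).
by rewrite nbl nbr.
Qed.

Lemma total_coalitionE A B : [disjoint A & B] ->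
  total_coalition k A B =
  [&& ~~ ((k <= nleft A) && (k <= nright A)),
      ~~ ((k <= nleft B) && (k <= nright B)),
      k <= nleft A + nleft B & k <= nright A + nright B].
Proof.
move=> dAB; rewrite /total_coalition dAB !total_dominatingE /=.
have cardU (X : {set G}) : #|X :&: (A :|: B)| = #|X :&: A| + #|X :&: B|.
  rewrite setIUr cardsU [_ :&: _ :&: _](_ : _ = set0) ?cards0 ?subn0 //.
  by rewrite -setIIr (disjoint_setI0 dAB) setI0.
by rewrite /nleft /nright !cardU.
Qed.

Lemma total_coalition_sym : symmetric (@total_coalition k G).
Proof.
by move=> A B; rewrite /total_coalition disjoint_sym setUC; do !bool_congr.
Qed.

Lemma total_coalition_irr : irreflexive (@total_coalition k G).
Proof.
move=> A; rewrite /total_coalition setUid.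
by do !case: total_dominating; rewrite ?andbF.
Qed.

(** * Upper bounds *)

Lemma total_coalition_partition_bound Omega :
    s <= t -> total_coalition_partition k Omega ->
  #|Omega| + k <= t + 2 \/ #|Omega| + 4 * k <= s + t + 4.
Proof.
move=> le_st /andP[partO /forall_inP coalO].
have O_neq0 : Omega != set0.
  apply/eqP=> O0; have := cover_partition partO.
  rewrite O0 /cover big_set0 => /setP/(_ (inl (Ordinal s_gt0))).
  by rewrite !inE.
have deg A : A \in Omega -> exists2 B, B \in Omega & total_coalition k A B.
  by move=> /coalO/exists_inP[B OB /andP[_ cAB]]; exists B.
have disjO A B : total_coalition k A B -> [disjoint A & B] by case/and4P.
(* The dichotomy is applied to the graph on [Omega] whose edges are the coalition pairs. *)
have [[A OA starA]|[A [B [C [D [uniqJ sJ cAB cCD]]]]]] :=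
  star_or_disjoint_edges total_coalition_sym total_coalition_irr O_neq0 deg.
  have coalA B : B \in Omega -> B != A ->
      [/\ ~~ ((k <= nleft A) && (k <= nright A)),
          k <= nleft A + nleft B & k <= nright A + nright B].
    move=> OB BA; have cAB := starA B OB BA.
    by move: (cAB); rewrite total_coalitionE ?disjO // => /and4P[].
  have [B OB cAB] := deg A OA.
  have BA : B != A by apply: contraTneq cAB => ->; rewrite total_coalition_irr.
  have O_gt1 : 1 < #|Omega| by apply/card_gt1P; exists A, B; rewrite eq_sym.
  have [+ _ _] := coalA B OB BA.
  (* The centre [A] is not dominating, so it has fewer than [k] vertices on some side. A deficit on
     the left gives the bound with [s], which is at most [t]. *)
  rewrite negb_and -!ltnNge => /orP[ltA|ltA]; left.
    suff: #|Omega| + k <= s + 2 by lia.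
    rewrite -[s in s + 2]card_left_side; apply: leq_card_partition_star partO O_gt1 OA ltA _.
    by move=> C OC CA; have [] := coalA C OC CA.
  rewrite -[t in t + 2]card_right_side; apply: leq_card_partition_star partO O_gt1 OA ltA _.
  by move=> C OC CA; have [] := coalA C OC CA.
right; have := leq_card_partition partO uniqJ sJ.
(* Each of the two pairs has at least [k] vertices on each side, so the four parts have at least
   [4 * k] vertices. *)
rewrite !big_cons big_nil cardsT card_sum !card_ord !card_nleft_nright /=.
move: (cAB) (cCD); rewrite !total_coalitionE ?disjO // => /and4P[_ _ ? ?] /and4P[_ _ ? ?].
lia.
Qed.

(** * Partitions attaining the bounds *)

Lemma leq_total_coalition_number Omega :
    partition Omega [set: G] ->
    (forall A, A \in Omega -> exists2 B, B \in Omega & total_coalition k A B) ->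
  #|Omega| <= total_coalition_number k G.
Proof.
move=> partO coalO; apply: (leq_bigmax_cond (F := fun P : {set {set G}} => #|P|)).
rewrite /total_coalition_partition partO /=; apply/forall_inP=> A OA.
have [B OB cAB] := coalO A OA; apply/exists_inP; exists B; rewrite ?cAB ?andbT //.
by apply: contraTneq cAB => ->; rewrite total_coalition_irr.
Qed.

(** Index intervals on both sides realize prescribed side counts and make disjointness an arithmetic
    fact. *)
Definition box (a b c d : nat) : {set G} :=
  [set v : G | match v with inl i => a <= i < b | inr j => c <= j < d end].

Lemma card_ord_interval n a b : b <= n -> #|[set i : 'I_n | a <= i < b]| = b - a.
Proof.
move=> le_bn; rewrite -[b - a]muln1 -sum_nat_const_nat (big_nat_widen _ _ n) //.
rewrite (big_nat_widenl _ 0) // big_mkord cardsE -sum1_card.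
by apply: eq_bigl => i; rewrite andbC.
Qed.

Lemma nleft_box a b c d : b <= s -> nleft (box a b c d) = b - a.
Proof.
move=> le_bs; rewrite -(card_ord_interval a le_bs).
rewrite -(card_imset _ (@inl_inj 'I_s 'I_t)); apply: eq_card => v.
rewrite !inE in_left_side; case: v => [i|j] /=.
  by rewrite mem_imset ?inE //; exact: inl_inj.
by apply/esym/negP=> /imsetP[].
Qed.

Lemma nright_box a b c d : d <= t -> nright (box a b c d) = d - c.
Proof.
move=> le_dt; rewrite -(card_ord_interval c le_dt).
rewrite -(card_imset _ (@inr_inj 'I_s 'I_t)); apply: eq_card => v.
rewrite !inE in_right_side; case: v => [i|j] /=.
  by apply/esym/negP=> /imsetP[].
by rewrite mem_imset ?inE //; exact: inr_inj.
Qed.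

(** The large part [A] takes the whole left side and [k - 1] right vertices, so any of the
    [t - k + 1] remaining vertices completes it. *)
Lemma total_coalition_number_one_big : k <= s -> k <= t ->
  t - k + 2 <= total_coalition_number k G.
Proof.
move=> le_ks le_kt; pose A := box 0 s 0 k.-1.
have nlA : nleft A = s by rewrite nleft_box ?subn0.
have nrA : nright A = k.-1 by rewrite nright_box ?subn0 //; lia.
have A_neq0 : A != set0 by rewrite -card_gt0 card_nleft_nright; lia.
have partS := partition_singletons (~: A).
have dA : [disjoint A & ~: A] by rewrite -setI_eq0 setICr.
have partO := partitionU1 partS A_neq0 dA; rewrite setUCr in partO.
have coalA v : v \notin A -> total_coalition k A [set v].
  move=> vA; rewrite total_coalitionE; last by rewrite disjoint_sym disjoints1.
  rewrite nlA nrA nleft1 nright1.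
  by case: v vA => [i|j]; rewrite !inE ?ltn_ord //=; lia.
apply: leq_trans (leq_total_coalition_number partO _).
  rewrite cardsU1 (partition_notin partS) // card_singletons cardsCs setCK.
  by rewrite card_sum !card_ord card_nleft_nright nlA nrA; lia.
move=> _ /setU1P[->|/imsetP[v + ->]].
  (* The right vertex of index [k - 1] is the first one outside [A]; its singleton is a partner for
     [A]. *)
  have lt_k1t : k.-1 < t by lia.
  have vA : inr (Ordinal lt_k1t) \notin A by rewrite inE /= ltnn.
  exists [set inr (Ordinal lt_k1t)]; last exact: coalA.
  by rewrite !inE imset_f ?orbT // inE.
by rewrite inE => vA; exists A; rewrite ?setU11 // total_coalition_sym coalA.
Qed.

(* With truncated subtraction, [s + t - 4 * k + 4] would be too large when
   [s + t < 4 * k]. *)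
Lemma total_coalition_number_two_big : 2 * k - 1 <= s -> 2 * k - 1 <= t ->
  s + t + 4 - 4 * k <= total_coalition_number k G.
Proof.
(* [A] lacks one right vertex and [B] lacks one left vertex. Together they use [4 * k - 2] vertices,
   and the rest become singletons. *)
move=> le_ks le_kt; pose A := box 0 k 0 k.-1; pose B := box k (2 * k - 1) k.-1 (2 * k - 1).
have nlA : nleft A = k by rewrite nleft_box ?subn0 //; lia.
have nrA : nright A = k.-1 by rewrite nright_box ?subn0 //; lia.
have nlB : nleft B = k.-1 by rewrite nleft_box //; lia.
have nrB : nright B = k by rewrite nright_box //; lia.
have A_neq0 : A != set0 by rewrite -card_gt0 card_nleft_nright; lia.
have B_neq0 : B != set0 by rewrite -card_gt0 card_nleft_nright; lia.
have dAB : [disjoint A & B].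
  by rewrite -setI_eq0; apply/eqP/setP=> -[i|j]; rewrite !inE; lia.
have cAB : total_coalition k A B by rewrite total_coalitionE // nlA nrA nlB nrB; lia.
pose S := ~: (A :|: B); have partS := partition_singletons S.
have dBS : [disjoint B & S] by rewrite -setI_eq0 /S setCU setICA setICr setI0.
have partB := partitionU1 partS B_neq0 dBS.
have dABS : [disjoint A & B :|: S].
  by rewrite -setI_eq0 setIUr (disjoint_setI0 dAB) set0U /S setCU setIA setICr set0I.
have partO := partitionU1 partB A_neq0 dABS.
have ABS : A :|: (B :|: S) = setT by rewrite setUA setUCr.
rewrite ABS in partO.
apply: leq_trans (leq_total_coalition_number partO _).
  rewrite !cardsU1 (partition_notin partB) // (partition_notin partS) //.
  rewrite card_singletons cardsCs setCK card_sum !card_ord cardsU (disjoint_setI0 dAB).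
  by rewrite cards0 !card_nleft_nright nlA nrA nlB nrB; lia.
move=> _ /setU1P[->|/setU1P[->|/imsetP[v + ->]]].
- by exists B => //; rewrite setU1r ?setU11.
- by exists A; rewrite ?setU11 // total_coalition_sym.
rewrite in_setC in_setU negb_or => /andP[vA vB].
(* A left singleton completes [B], a right singleton completes [A]. *)
case: v vA vB => v vA vB.
  exists B; first by rewrite setU1r ?setU11.
  by rewrite total_coalitionE ?disjoints1 // nleft1 nright1 nlB nrB; lia.
exists A; first exact: setU11.
by rewrite total_coalitionE ?disjoints1 // nleft1 nright1 nlA nrA; lia.
Qed.

End CompleteBipartite.

Theorem theorem5p3 (s t k : nat) (hs : 0 < s) (ht : 0 < t) (hk : 0 < k)
    (hst : s <= t) (hks : k <= s) :
  (k <= s <= 3 * k - 2 ->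
     total_coalition_number k (complete_bipartite s t) = t - k + 2) /\
  (3 * k - 1 <= s ->
     total_coalition_number k (complete_bipartite s t) = s + t - 4 * k + 4).
Proof.
have one_big := total_coalition_number_one_big hs ht hk hks (leq_trans hks hst).
split=> hs3; apply/eqP; rewrite eqn_leq; apply/andP; split=> //.
(* The bound [s + t - 4k + 4] is at most [t - k + 2] exactly when [s <= 3k - 2], so the larger bound
   is the claimed value in each case. *)
- by apply/bigmax_leqP=> Omega /(total_coalition_partition_bound hs ht hk hst)[]; lia.
- by apply/bigmax_leqP=> Omega /(total_coalition_partition_bound hs ht hk hst)[]; lia.
(* Here [s + t >= 6k - 2 >= 4k], so both truncated expressions agree. *)
suff: s + t + 4 - 4 * k <= total_coalition_number k (complete_bipartite s t) by lia.
by apply: total_coalition_number_two_big; lia.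
Qed.
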